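(* Consider the frog model on $\mathbb{Z}$ with drift parameter $p$, where $\frac12 < p \le 1$, and let $m_n$ be the minimum of the locations of the active frogs at time $n$. Then the speed of the minimum $v_{\min} = \lim_{n\to\infty} \frac{m_n}{n}$ exists almost surely and is given by $v_{\min} = 2p-1$; that is, $\lim_{n\to\infty} \frac{m_n}{n} = 2p-1$ almost surely.
   Context: Frog model on $\mathbb{Z}$ with drift parameter $p\in[\frac12,1]$: $\mathbb{N}=\{1,2,\dots\}$, $\mathbb{N}_0=\mathbb{N}\cup\{0\}$. Let $(X_k^i)_{i\in\mathbb{Z},k\in\mathbb{N}}$ be i.i.d. with $\mathbb{P}(X_1^0=1)=p=1-\mathbb{P}(X_1^0=-1)$, and $S_n^i=\sum_{k=1}^n X_k^i$ for $i\in\mathbb{Z}$, $n\in\mathbb{N}_0$. Initially there is one active frog at $0$ and one sleeping frog at every other site of $\mathbb{Z}$. An active frog moves at each discrete time step according to its own random walk; a sleeping frog does not move, and it becomes active the first time an active frog visits its site, after which it starts its own walk and can wake up other frogs. The frog initially at $i$ is activated at time $T_i\in\mathbb{N}_0\cup\{\infty\}$; formally, with $t(x,y)=\inf\{n\in\mathbb{N}_0: x+S_n^x=y\}$ ($\inf\emptyset=\infty$), $T_i=\inf \sum_{l=1}^{k} t(x_{l-1},x_l)$, the infimum being over all $k\in\mathbb{N}$ and finite sequences $x_0,\dots,x_k\in\mathbb{Z}$ with $x_0=0$, $x_k=i$; in particular $T_0=0$. Its location at time $n$ is $Z_n^i=i$ if $n<T_i$ and $Z_n^i=i+S^i_{n-T_i}$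 if $n\ge T_i$. The set of active frogs at time $n$ is $A_n=\{i\in\mathbb{Z}:T_i\le n\}$, and $m_n=\min_{i\in A_n}Z_n^i$. *)

(* Defs.v *)
From HB Require Import structures.
From mathcomp Require Import all_boot all_order all_algebra finmap.
From mathcomp Require Import all_classical all_reals all_analysis.

Set Implicit Arguments.
Unset Strict Implicit.
Unset Printing Implicit Defensive.

Import Order.TTheory GRing.Theory Num.Theory.
Import numFieldNormedType.Exports.

Local Open Scope classical_set_scope.
Local Open Scope ring_scope.

HB.instance Definition _ := isPointed.Build int 0.
(* Discrete sigma-algebra, as the library does for nat and bool. *)
HB.instance Definition _ := @isMeasurable.Build default_measure_display
  int discrete_measurable discrete_measurable0
  discrete_measurableC discrete_measurableU.

Section iid.
Context d d' (Omega : measurableType d) (E : measurableType d') (R : realType).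
Context (P : probability Omega R) (I : choiceType).

Definition mutually_independent (D : set I) (X : I -> {RV P >-> E}) : Prop :=
  forall (J : {fset I}) (B : I -> set E),
    [set` J] `<=` D -> (forall j, measurable (B j)) ->
    P (\bigcap_(j in [set` J]) (X j @^-1` B j)) =
    (\prod_(j <- J) P (X j @^-1` B j))%E.

Definition identically_distributed (D : set I) (X : I -> {RV P >-> E}) : Prop :=
  forall i j, D i -> D j -> forall B : set E, measurable B ->
    distribution P (X i) B = distribution P (X j) B.

Definition iid (D : set I) (X : I -> {RV P >-> E}) : Prop :=
  mutually_independent D X /\ identically_distributed D X.

End iid.

(* The frog model is a deterministic function of the steps: [s i k] is the
   [k]-th step, [k >= 1], of the frog starting at [i]; [s i 0] is never used. *)
Section frog_model.
Context (R : realType).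
Implicit Types (s : int -> nat -> int) (i x y : int) (n k : nat).

Definition walk s i n : int := \sum_(1 <= k < n.+1) s i k.

Definition hitting_time s x y : \bar R :=
  ereal_inf [set n%:R%:E | n in [set n | x + walk s x n = y]].

(* A sequence x_0, ..., x_k is given by a function on nat of which only the
   first k + 1 values matter. *)
Definition activation_time s i : \bar R :=
  ereal_inf [set u | exists k (x : nat -> int),
    [/\ (0 < k)%N, x 0%N = 0, x k = i &
        u = (\sum_(1 <= l < k.+1) hitting_time s (x l.-1) (x l))%E]].

(* Activation times are natural numbers or +oo, so [Num.truncn] is exact. *)
Definition location s i n : int :=
  if (n%:R%:E < activation_time s i)%E then i
  else i + walk s i (n - Num.truncn (fine (activation_time s i))).

Definition active s n : set int := [set i | (activation_time s i <= n%:R%:E)%E].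

Definition is_minimum (A : set int) (m : int) : Prop := A m /\ lbound A m.

(* The default value 0 is not used: the set of locations of the active frogs is
   finite and nonempty, see [min_location_is_minimum]. *)
Definition min_location s n : int :=
  xget 0 (is_minimum [set location s i n | i in active s n]).

Let ninf (u : \bar R) := u = +oo%E \/ exists n, u = n%:R%:E.

Let ereal_inf_ninf (A : set (\bar R)) : (forall u, A u -> ninf u) ->
  ereal_inf A = +oo%E \/ exists2 n, ereal_inf A = n%:R%:E & A n%:R%:E.
Proof.
move=> An; have [[n An0]|/forallNP noA] := pselect (exists n, A n%:R%:E).
  have exA : exists n, `[< A n%:R%:E >] by exists n; apply/asboolP.
  right; case: (ex_minnP exA) => m /asboolP Am mmin.
  exists m => //; apply/le_anti/andP; split; first exact: ereal_inf_lbound.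
  apply: le_ereal_inf_tmp => u Au; have [->|[k uk]] := An _ Au; first exact: leey.
  rewrite uk lee_fin ler_nat; apply: mmin; apply/asboolP; by rewrite -uk.
left; apply/eqP; rewrite -leye_eq; apply: le_ereal_inf_tmp => u Au.
by have [->//|[k uk]] := An _ Au; case: (noA k); rewrite -uk.
Qed.

Let hitting_timeP s x y : hitting_time s x y = +oo%E \/
  exists2 n, hitting_time s x y = n%:R%:E & x + walk s x n = y.
Proof.
have [] := @ereal_inf_ninf [set n%:R%:E | n in [set n | x + walk s x n = y]].
- by move=> u [n _ <-]; right; exists n.
- by move=> h; left.
- move=> [n hn [k hk [/eqP]]]; rewrite eqr_nat => /eqP kn.
  by right; exists n => //; rewrite -kn.
Qed.

Let sum_ninf s k (x : nat -> int) :
  ninf (\sum_(1 <= l < k.+1) hitting_time s (x l.-1) (x l))%E.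
Proof.
elim: k => [|k [ih|[n ih]]].
- by rewrite big_geq//; right; exists 0%N.
- rewrite big_nat_recr//= ih; left.
  by have [->|[n ->]] := hitting_timeP s (x k) (x k.+1).
- rewrite big_nat_recr//= ih.
  have [->|[m ->]] := hitting_timeP s (x k) (x k.+1); first by left.
  by right; exists (n + m)%N; rewrite natrD EFinD.
Qed.

Lemma activation_time_nat s i :
  activation_time s i = +oo%E \/ exists n, activation_time s i = n%:R%:E.
Proof.
have [] := @ereal_inf_ninf [set u | exists k (x : nat -> int),
    [/\ (0 < k)%N, x 0%N = 0, x k = i &
        u = (\sum_(1 <= l < k.+1) hitting_time s (x l.-1) (x l))%E]].
- by move=> u [k [x [_ _ _ ->]]]; exact: sum_ninf.
- by move=> h; left.
- by move=> [n h _]; right; exists n.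
Qed.

Lemma activation_time0 s : activation_time s 0 = 0%E.
Proof.
have h0 : (hitting_time s 0 0 <= 0)%E.
  by apply: ereal_inf_lbound; exists 0%N => //=; rewrite /walk big_geq.
apply/le_anti/andP; split.
  apply: le_trans h0; apply: ereal_inf_lbound.
  by exists 1%N, (fun=> 0); split => //; rewrite big_nat1.
by have [->//|[n ->]] := activation_time_nat s 0; rewrite lee_fin.
Qed.

Let reached s n i := exists k (x : nat -> int), [/\ x 0%N = 0, x k = i &
  (\sum_(1 <= l < k.+1) hitting_time s (x l.-1) (x l) <= n%:R%:E)%E].

Let reached_step s n i : reached s n i ->
  i = 0 \/ exists y, [/\ (0 < n)%N, reached s n.-1 y &
    exists2 m, (m < n.+1)%N & y + walk s y m = i].
Proof.
move=> [k [x [x0 <- ]]]; elim: k => [|k ih]; first by left.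
rewrite big_nat_recr//=.
have [<-|xk] := eqVneq (x k) (x k.+1).
  move=> h; apply: ih; apply: le_trans h; rewrite leeDl//.
  by have [->//|[m ->]] := hitting_timeP s (x k) (x k); rewrite lee_fin.
have [a|[a ha]] := sum_ninf s k x.
  by rewrite a; have [->//|[m ->]] := hitting_timeP s (x k) (x k.+1).
have [->|[m -> hm]] := hitting_timeP s (x k) (x k.+1); first by rewrite ha.
rewrite ha -EFinD lee_fin -natrD ler_nat => amn; right; exists (x k).
have m0 : (0 < m)%N.
  by rewrite lt0n; apply: contraNneq xk => m0; rewrite -hm m0 /walk big_geq// addr0.
split; first by rewrite (leq_trans m0)// (leq_trans _ amn)// leq_addl.
  exists k, x; split => //; rewrite ha lee_fin ler_nat -ltnS prednK.
    by rewrite (leq_trans _ amn)// -addn1 leq_add2l.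
  by rewrite (leq_trans m0)// (leq_trans _ amn)// leq_addl.
by exists m => //; rewrite ltnS (leq_trans _ amn)// leq_addl.
Qed.

Let finite_reached s n : finite_set (reached s n).
Proof.
elim: n => [|n ih].
  apply: (@sub_finite_set _ _ [set 0]); last exact: finite_set1.
  by move=> i /reached_step[//|[y []]].
pose B := \bigcup_(y in reached s n) [set y + walk s y m | m in `I_n.+2].
apply: (@sub_finite_set _ _ ([set 0] `|` B)).
  move=> i /reached_step[->|[y [_ /= ry [m mn ym]]]]; first by left.
  by right; exists y => //; exists m.
rewrite finite_setU; split; first exact: finite_set1.
by apply: bigcup_finite => // y _; apply: finite_image; exact: finite_II.
Qed.

Lemma finite_active s n : finite_set (active s n).
Proof.
apply: sub_finite_set (finite_reached s n) => i /=; rewrite /active /=.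
have [] := @ereal_inf_ninf [set u | exists k (x : nat -> int),
    [/\ (0 < k)%N, x 0%N = 0, x k = i &
        u = (\sum_(1 <= l < k.+1) hitting_time s (x l.-1) (x l))%E]].
- by move=> u [k [x [_ _ _ ->]]]; exact: sum_ninf.
- by rewrite -/(activation_time s i) => ->.
- rewrite -/(activation_time s i) => -[m -> [k [x [_ x0 xk ->]]]] h.
  by exists k, x.
Qed.

Lemma min_location_is_minimum s n :
  is_minimum [set location s i n | i in active s n] (min_location s n).
Proof.
rewrite /min_location; case: xgetP => // nomin; exfalso.
have /finite_seqP[r rE] :
    finite_set [set location s i n | i in active s n].
  by apply: finite_image; exact: finite_active.
have r0 : location s 0 n \in r.
  suff : [set` r] (location s 0 n) by [].
  by rewrite -rE; exists 0 => //; rewrite /active /= activation_time0 lee_fin.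
have [m mr mmin] : exists2 m, m \in r & {in r, forall z, m <= z}.
  case: r r0 {rE nomin} => // a r _; elim: r a => [|b r ih] a.
    by exists a => [|z]; rewrite inE// => /eqP ->.
  have [m mr mmin] := ih b; have [am|ma] := leP a m.
    exists a => [|z]; first by rewrite mem_head.
    by rewrite inE => /predU1P[->//|/mmin]; exact: le_trans.
  exists m => [|z]; first by rewrite inE mr orbT.
  by rewrite inE => /predU1P[->|/mmin//]; exact: ltW.
by apply: (nomin m); rewrite rE; split => [//|z /mmin].
Qed.

End frog_model.

(* Main.v *)
Require Import Defs.
From mathcomp Require Import all_boot all_order all_algebra finmap.
From mathcomp Require Import all_classical all_reals all_analysis.
From mathcomp Require Import zify ring lra.

Set Implicit Arguments.
Unset Strict Implicit.
Unset Printing Implicit Defensive.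

Import Order.TTheory GRing.Theory Num.Theory.
Import numFieldNormedType.Exports.
Local Open Scope classical_set_scope.
Local Open Scope ring_scope.

(** Write [v = 2 * p - 1] and let frog [i] be the one that starts at [i].  Frog
[0] is active from time [0], so the minimum is at most its location, which grows
at speed [v] by the law of large numbers.

For the lower bound, the law of large numbers is made uniform: almost surely, for
every [e > 0] and all large [n], every frog [i] with [|i| <= n] has a walk that
after [m <= n] steps differs from [v * m] by at most [e * n].  This comes from an
exponential moment bound, a union bound over polynomially many pairs [(i, m)] and
the Borel-Cantelli argument ([ae_deviates_eventually]).  Only frogs with
[|i| <= n] matter at time [n], since walks are nearest neighbour.

A frog [i >= 0] woken at time [t <= n] has not lost ground on the linear
profile: frog [0] cannot have passed [i] before [t], or it would have woken frog
[i] earlier, hence [i >= S_t >= v * t - e * n] where [S] is the walk of frog [0]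
([walk_le_activation]).  At time [n] frog [i] is therefore at
[i + (n - t) * v - e * n >= v * n - 2 * e * n] or to the right.

A frog [i < 0] could be woken late and far to the left, so it must be shown that
only finitely many of these frogs are ever woken; each of them then has speed [v].
It is enough that some site [y < 0] is never visited by a frog starting to the
right of [y], because a chain of wakings that goes beyond [y] has to cross it
([activation_time_blocked]).  Such a site exists almost surely
([ae_blocked_site]): with [rho = (1 - p) / p < 1], a frog at distance [j] to the
right of [y] reaches [y] with probability at most [rho ^ j] by the classical
gambler's ruin estimate, so the [M] nearest frogs all miss [y] with probability at
least the Euler product of the [1 - rho ^ j], which is bounded below by some
[c > 0] independently of [M].  For the left ends of [K] disjoint blocks of [M]
sites these events are independent, and one of them occurs with probability at
least [1 - (1 - c) ^ K]; the frogs outside the blocks contribute a geometric tail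
in [M].

All probabilities are computed on finitely many steps, as iterated means over
independent coins ([coin_mean], [prob_steps_event]); unbounded time horizons are
reached by monotone limits ([negligible_of_covers]). *)

(** * Means over finitely many independent coins *)

Section coin_mean.
Context (R : realFieldType) (I : eqType) (p : R).
Implicit Types (s : seq I) (x y : I -> int) (F G : (I -> int) -> R).

Definition update x (j : I) (v : int) : I -> int :=
  fun k => if k == j then v else x k.

(** The mean of [F] when the coordinates listed in [s] are replaced by
independent steps, [1] with weight [p] and [-1] with weight [1 - p], the other
coordinates being those of [x].  Iterating one-coordinate means makes first-step
analysis and independence of disjoint lists matters of computation. *)
Fixpoint coin_mean s F x : R :=
  if s is j :: s' then
    p * coin_mean s' F (update x j 1) + (1 - p) * coin_mean s' F (update x j (-1))
  else F x.

Definition agree_off s x y := forall k, k \notin s -> y k = x k.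

Definition depends_on (T : Type) s (F : (I -> int) -> T) :=
  forall x y, {in s, x =1 y} -> F x = F y.

Lemma agree_off_update s x y j v :
  agree_off s (update x j v) y -> agree_off (j :: s) x y.
Proof.
by move=> h k; rewrite inE negb_or => /andP[/negbTE kj ks]; rewrite h// /update kj.
Qed.

Lemma eq_coin_mean s F G x : (forall y, agree_off s x y -> F y = G y) ->
  coin_mean s F x = coin_mean s G x.
Proof.
elim: s x => [|j s ih] x FG /=; first by apply: FG.
by congr (_ * _ + _ * _); apply: ih => y /agree_off_update; exact: FG.
Qed.

Lemma le_coin_mean s F G x : 0 <= p <= 1 ->
  (forall y, agree_off s x y -> F y <= G y) ->
  coin_mean s F x <= coin_mean s G x.
Proof.
move=> /andP[p0 p1]; elim: s x => [|j s ih] x FG /=; first by apply: FG.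
by apply: lerD; apply: ler_wpM2l; rewrite ?subr_ge0//; apply: ih => y
  /agree_off_update; exact: FG.
Qed.

Lemma coin_mean_cst s c x : coin_mean s (fun=> c) x = c.
Proof. by elim: s x => //= j s ih x; rewrite !ih -mulrDl addrC subrK mul1r. Qed.

Lemma coin_mean_cat s t F x :
  coin_mean (s ++ t) F x = coin_mean s (coin_mean t F) x.
Proof. by elim: s x => //= j s ih x; rewrite !ih. Qed.

Lemma coin_meanD s F G x :
  coin_mean s (fun y => F y + G y) x = coin_mean s F x + coin_mean s G x.
Proof. by elim: s x => //= j s ih x; rewrite !ih; ring. Qed.

Lemma coin_meanZ s c F x : coin_mean s (fun y => c * F y) x = c * coin_mean s F x.
Proof. by elim: s x => //= j s ih x; rewrite !ih; ring. Qed.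

Lemma coin_mean_subl s F x : coin_mean s (fun y => 1 - F y) x = 1 - coin_mean s F x.
Proof. by elim: s x => //= j s ih x; rewrite !ih; ring. Qed.

Lemma coin_mean_agree s t F x y : depends_on t F ->
  (forall k, k \in t -> k \notin s -> x k = y k) ->
  coin_mean s F x = coin_mean s F y.
Proof.
move=> Ft; elim: s x y => [|j s ih] x y xy /=.
  by apply: Ft => k kt; apply: xy.
by congr (_ * _ + _ * _); apply: ih => k kt ks; rewrite /update;
  case: eqVneq => // kj; apply: xy => //; rewrite inE negb_or kj.
Qed.

Lemma depends_on_coin_mean s F x y : depends_on s F ->
  coin_mean s F x = coin_mean s F y.
Proof. by move=> Fs; apply: (coin_mean_agree Fs) => k ->. Qed.

Lemma coin_mean_ge0 s F x : 0 <= p <= 1 -> (forall y, 0 <= F y) ->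
  0 <= coin_mean s F x.
Proof.
by move=> p01 F0; rewrite -(coin_mean_cst s 0 x); apply: le_coin_mean.
Qed.

(** Functions of pairwise disjoint sets of coins are independent: all the factors
but one are constant while a block is averaged. *)
Lemma coin_mean_prod (T : Type) (bs : seq T) (s : T -> seq I)
    (F : T -> (I -> int) -> R) x :
  uniq (flatten (map s bs)) -> (forall b, depends_on (s b) (F b)) ->
  coin_mean (flatten (map s bs)) (fun y => \prod_(b <- bs) F b y) x =
  \prod_(b <- bs) coin_mean (s b) (F b) x.
Proof.
move=> + Fs; elim: bs x => [|b bs ih] x /=; first by rewrite !big_nil.
rewrite cat_uniq => /and3P[_ /hasPn sbs ubs]; rewrite coin_mean_cat big_cons.
rewrite [RHS]mulrC -coin_meanZ; apply: eq_coin_mean => y _.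
rewrite mulrC -(_ : \prod_(b <- bs) coin_mean (s b) (F b) y =
    \prod_(b <- bs) coin_mean (s b) (F b) x); last first.
  by apply: eq_bigr => c _; exact: depends_on_coin_mean.
rewrite -ih// -coin_meanZ; apply: eq_coin_mean => z zy.
rewrite big_cons; congr (_ * _); apply: (Fs b) => k kb; apply: zy.
by apply: contraL kb => /sbs.
Qed.

Lemma coin_mean_prod_steps s (g : int -> R) x : uniq s ->
  coin_mean s (fun y => \prod_(j <- s) g (y j)) x =
  (p * g 1 + (1 - p) * g (-1)) ^+ size s.
Proof.
move=> us; have sE : s = flatten (map (fun j => [:: j]) s).
  by elim: {us} s => //= j s <-.
rewrite {1}sE (coin_mean_prod (F := fun j y => g (y j))) -?sE//.
- rewrite (eq_bigr (fun=> p * g 1 + (1 - p) * g (-1))) => [|j _].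
    by rewrite big_const_seq count_predT iter_mulr_1.
  by rewrite /= /update eqxx.
- by move=> j y z /(_ j); rewrite mem_head => ->.
Qed.

End coin_mean.

(** * The law of finitely many steps *)

Section steps_law.
Context d (Omega : measurableType d) (R : realType) (P : probability Omega R).
Context (I : choiceType) (D : set I) (p : R) (X : I -> {RV P >-> int}).
Context (indep : mutually_independent D X).
Context (lawp : forall j, D j -> P (X j @^-1` [set 1]) = p%:E).
Context (lawm : forall j, D j -> P (X j @^-1` [set -1]) = (1 - p)%:E).
Implicit Types (s t : seq I) (x : I -> int) (f : (I -> int) -> bool).

Definition steps (w : Omega) : I -> int := fun j => X j w.

Definition step_weight (v : int) : R := if v == 1 then p else 1 - p.

Lemma measurable_step j (v : int) : measurable [set w | X j w = v].
Proof.
by rewrite -[X in measurable X]setTI; exact: (measurable_funPT (X j) measurableT [set v]).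
Qed.

(** The steps take countably many values, so the event splits into countably many
pieces along the value of one coordinate. *)
Lemma measurable_steps_event s f : depends_on s f ->
  measurable [set w | f (steps w)].
Proof.
elim: s f => [|j s ih] f fs.
  have [f0|/negP f0] := boolP (f (fun=> 0)).
    by rewrite (_ : [set _ | _] = setT)//; apply/seteqP; split => // w _ /=;
      rewrite (fs _ (fun=> 0)).
  rewrite (_ : [set _ | _] = set0)//; apply/seteqP; split => // w /=.
  by rewrite (fs _ (fun=> 0)).
rewrite (_ : [set _ | _] =
    \bigcup_v ([set w | X j w = v] `&` [set w | f (update (steps w) j v)])).
  apply: countable_bigcupT_measurable; first exact: countableP.
  move=> v; apply: measurableI; first exact: measurable_step.
  apply: (ih (fun x => f (update x j v))) => x y xy; apply: fs => k.
  by rewrite inE /update; case: eqVneq => //= _; exact: xy.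
apply/seteqP; split => w /=.
  move=> fw; exists (X j w) => //; split => //=.
  by rewrite (fs _ (steps w))// => k _; rewrite /update; case: eqVneq => // ->.
move=> [v _ [/= <-]]; rewrite (fs _ (steps w))// => k _.
by rewrite /update; case: eqVneq => // ->.
Qed.

Lemma prob_steps_eq t x : uniq t -> {in t, forall j, D j} ->
  {in t, forall j, x j = 1 \/ x j = -1} ->
  P [set w | {in t, forall j, X j w = x j}] =
  (\prod_(j <- t) step_weight (x j))%:E.
Proof.
move=> ut tD tx; have := @indep [fset j in t]%fset (fun j => [set x j]).
rewrite (_ : \bigcap_(_ in _) _ = [set w | {in t, forall j, X j w = x j}]).
  move=> -> //; last by move=> j /=; rewrite inE => /tD.
  rewrite -prodEFin (perm_big t) /=; last first.
    by apply: uniq_perm => // j; rewrite !inE.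
  apply: eq_big_seq => j jt; rewrite /step_weight.
  have [->|->] := tx _ jt; first by rewrite eqxx lawp//; exact: tD.
  by rewrite lawm//; exact: tD.
by apply/seteqP; split => w /= h j; move: (h j); rewrite /= ?inE.
Qed.

Lemma prob_step_pm1 j : D j -> P [set w | X j w = 1 \/ X j w = -1] = 1%E.
Proof.
move=> Dj; rewrite (_ : [set _ | _] = [set w | X j w = 1] `|` [set w | X j w = -1])//.
rewrite measureU; [|exact: measurable_step..|].
  rewrite [X in (X + _)%E](lawp Dj) [X in (_ + X)%E](lawm Dj) -EFinD.
  by rewrite addrC subrK.
by apply/seteqP; split => w //= [->].
Qed.

(** The coordinates of [s] are conditioned upon one by one; [t] holds those whose
values [x] are already fixed. *)
Let prob_steps_event_cond s t f x : uniq (s ++ t) ->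
  {in s ++ t, forall j, D j} -> {in t, forall j, x j = 1 \/ x j = -1} ->
  depends_on (s ++ t) f ->
  P ([set w | f (steps w)] `&` [set w | {in t, forall j, X j w = x j}]) =
  (coin_mean p s (fun y => (f y)%:R) x * \prod_(j <- t) step_weight (x j))%:E.
Proof.
have mcyl (u : seq I) (y : I -> int) : measurable [set w | {in u, forall j, X j w = y j}].
  pose g (z : I -> int) := all (fun j => z j == y j) u.
  rewrite (_ : [set _ | _] = [set w | g (steps w)]).
    apply: (@measurable_steps_event u g) => z z' zz'.
    by apply: eq_in_all => j /zz' ->.
  apply/seteqP; split => w /= h; first by apply/allP => j /h /eqP.
  by move=> j ju; apply/eqP; move/allP : h; exact.
elim: s t x => [|j s ih] t x /=.
  move=> ut tD tx ft.
  have [fx|fx] := boolP (f x); rewrite ?mul1r ?mul0r.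
    rewrite -prob_steps_eq//; congr (P _); apply/seteqP; split => w /=; first by case.
    by move=> h; split => //; rewrite (ft _ x).
  rewrite (_ : _ `&` _ = set0) ?measure0//; apply/seteqP; split => w //= -[+ h].
  by rewrite (ft _ x)//; exact/negP.
rewrite mem_cat negb_or => /andP[/andP[js jt] ust] sD tx fst_.
set A := [set w | f (steps w)] `&` _.
have Dj : D j by apply: sD; rewrite mem_head.
have mA : measurable A.
  by apply: measurableI => //; exact: (measurable_steps_event fst_).
have split_step v : v = 1 \/ v = -1 -> P (A `&` [set w | X j w = v]) =
    (coin_mean p s (fun y => (f y)%:R) (update x j v) *
     (step_weight v * \prod_(i <- t) step_weight (x i)))%:E.
  move=> v1; have := ih (j :: t) (update x j v).
  rewrite big_cons (_ : update x j v j = v); last by rewrite /update eqxx.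
  have -> : \prod_(i <- t) step_weight (update x j v i) =
      \prod_(i <- t) step_weight (x i).
    apply: eq_big_seq => i it; rewrite /update; case: eqVneq => // ij.
    by rewrite ij (negbTE jt) in it.
  move=> <-.
  - congr (P _); rewrite /A -setIA; congr (_ `&` _); apply/seteqP; split => w /=.
      move=> [h xv] i; rewrite inE /update; case: eqVneq => [->//|_ /=]; exact: h.
    move=> h; split; last by rewrite (h j) ?mem_head// /update eqxx.
    move=> i it; rewrite (h i) ?inE ?it ?orbT// /update.
    by case: eqVneq => // ij; rewrite ij (negbTE jt) in it.
  - move: ust; rewrite !cat_uniq /= => /and3P[-> st ->]; rewrite jt !andbT /=.
    by rewrite negb_or js st.
  - by move=> i; rewrite mem_cat inE orbCA -mem_cat => h; apply: sD; rewrite inE.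
  - move=> i; rewrite inE /update; case: eqVneq => //= _; exact: tx.
  - move=> y z yz; apply: fst_ => i; rewrite inE mem_cat => h; apply: yz.
    by rewrite mem_cat inE orbCA.
set E := [set w | X j w = 1 \/ X j w = -1].
have mE : measurable E by apply: measurableU; exact: measurable_step.
have AE0 : P (A `\` E) = 0%E.
  apply/eqP; rewrite -measure_le0; apply: (@le_trans _ _ (P (~` E))).
    apply: le_measure; rewrite ?inE; [exact: measurableD|exact: measurableC|].
    by move=> w [].
  by rewrite probability_setC// [X in (1 - X)%E](prob_step_pm1 Dj) subee.
have PA : P A = (P (A `\` E) + P (A `&` E))%E := measureDI P mA mE.
have PU : P (A `&` E) = (P (A `&` [set w | X j w = 1]%R) +
    P (A `&` [set w | X j w = -1]%R))%E.
  rewrite (_ : A `&` E =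
    (A `&` [set w | X j w = 1]) `|` (A `&` [set w | X j w = -1])); last first.
    by rewrite -setIUr.
  apply: measureU; [exact: measurableI (measurable_step _ _)..|].
  by apply/seteqP; split => w //= [[_ ->] []].
rewrite PA AE0 add0e PU !split_step; [|by right|by left].
by rewrite -EFinD /step_weight eqxx /=; congr _%:E; ring.
Qed.

(** Every probability estimate below goes through this identity, which turns an
event on finitely many steps into a finite computation. *)
Lemma prob_steps_event s f x : uniq s -> {in s, forall j, D j} ->
  depends_on s f ->
  P [set w | f (steps w)] = (coin_mean p s (fun y => (f y)%:R) x)%:E.
Proof.
move=> us sD fs; have := @prob_steps_event_cond s [::] f x.
rewrite cats0 big_nil mulr1 => <- //; congr (P _).
by apply/seteqP; split => w //= [].
Qed.

End steps_law.

(** * Null sets from finite unions of events *)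

Section null_sets.
Context d (Omega : measurableType d) (R : realType) (P : probability Omega R).

Lemma measurable_finite_union (T : eqType) (r : seq T) (E : T -> set Omega) :
  {in r, forall t, measurable (E t)} ->
  measurable [set w | exists2 t, t \in r & E t w].
Proof.
elim: r => [|t r ih] mE.
  by rewrite (_ : [set _ | _] = set0)//; apply/seteqP; split => w //= [].
rewrite (_ : [set _ | _] = E t `|` [set w | exists2 t, t \in r & E t w]).
  apply: measurableU; first by apply: mE; rewrite mem_head.
  by apply: ih => u ur; apply: mE; rewrite inE ur orbT.
apply/seteqP; split => w /=.
  by move=> [u]; rewrite inE => /predU1P[->|ur] Eu; [left|right; exists u].
by move=> [Et|[u ur Eu]]; [exists t; rewrite ?mem_head|exists u; rewrite ?inE ?ur ?orbT].
Qed.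

Lemma prob_finite_union_le (T : eqType) (r : seq T) (E : T -> set Omega)
    (c : T -> R) :
  {in r, forall t, measurable (E t)} -> {in r, forall t, (P (E t) <= (c t)%:E)%E} ->
  (P [set w | exists2 t, t \in r & E t w] <= (\sum_(t <- r) c t)%:E)%E.
Proof.
elim: r => [|t r ih] mE PE.
  rewrite (_ : [set _ | _] = set0) ?measure0 ?big_nil//.
  by apply/seteqP; split => w //= [].
have mE' : {in r, forall t, measurable (E t)}.
  by move=> u ur; apply: mE; rewrite inE ur orbT.
rewrite (_ : [set _ | _] = E t `|` [set w | exists2 t, t \in r & E t w]).
  apply: (le_trans (measureU2 P _ _)).
  - by apply: mE; rewrite mem_head.
  - exact: measurable_finite_union.
  rewrite big_cons EFinD; apply: leeD; first by apply: PE; rewrite mem_head.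
  by apply: ih => // u ur; apply: PE; rewrite inE ur orbT.
apply/seteqP; split => w /=.
  by move=> [u]; rewrite inE => /predU1P[->|ur] Eu; [left|right; exists u].
by move=> [Et|[u ur Eu]]; [exists t; rewrite ?mem_head|exists u; rewrite ?inE ?ur ?orbT].
Qed.

(** By continuity from below, an event without time horizon is as unlikely as its
approximations with horizon [n], which are the sets [F n] in the applications. *)
Lemma negligible_of_covers (N : set Omega) :
  (forall e : R, 0 < e -> exists F : nat -> set Omega,
    [/\ forall n, measurable (F n), forall n, F n `<=` F n.+1,
        forall n, (P (F n) <= e%:E)%E & N `<=` \bigcup_n F n]) ->
  P.-negligible N.
Proof.
move=> cover.
have /choice[F hF] k := cover k.+1%:R^-1 ltac:(by rewrite invr_gt0).
have mU k : measurable (\bigcup_n F k n).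
  by have [mF _ _ _] := hF k; exact: bigcupT_measurable.
exists (\bigcap_k \bigcup_n F k n); split; first exact: bigcapT_measurable.
  apply/eqP; rewrite -measure_le0; apply/lee_addgt0Pr => e e0; rewrite add0e.
  pose k := Num.truncn e^-1; have [mF F_nd PF _] := hF k.
  have ke : k.+1%:R^-1 <= e.
    by rewrite invf_ple ?posrE// ltW// truncnS_gt.
  apply: (@le_trans _ _ (P (\bigcup_n F k n))).
    apply: le_measure; rewrite ?inE//; first exact: bigcapT_measurable.
    by move=> w /(_ k); exact.
  have Fle : {homo F k : n m / (n <= m)%N >-> (n <= m)%O}.
    apply: homo_leq => //; first by move=> A B C; exact: le_trans.
    by move=> n; rewrite subsetEset; exact: F_nd.
  have cvgP := @nondecreasing_cvg_mu _ _ _ P (F k) mF (mU k) Fle.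
  apply: (cvge_to_le cvgP).
  by near=> n; rewrite /= (le_trans (PF n))// lee_fin.
by move=> w Nw k _; have [_ _ _] := hF k; exact.
Unshelve. all: by end_near. Qed.

End null_sets.

(** * Large deviations of the walks *)

Section chernoff.
Context (R : realType).

(** Invert [1 - y <= expR (- y)] and expand the geometric series to second order. *)
Lemma expR_le_quadratic (y : R) : `|y| <= 2^-1 -> expR y <= 1 + y + 2 * y ^+ 2.
Proof.
rewrite ler_norml => /andP[y1 y2].
have : 1 - y <= expR (- y) by exact: expR_ge1Dx.
rewrite expRN => h; have y0 : 0 < 1 - y by lra.
have : expR y <= (1 - y)^-1 by rewrite -[leLHS]invrK lef_pV2// posrE invr_gt0 expR_gt0.
move=> /le_trans; apply; rewrite -[leLHS]mul1r ler_pdivrMr//; nra.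
Qed.

(** The step has mean [2 * p - 1], so the linear terms cancel; the centred step is
at most [2] in absolute value, whence [8 = 2 * 2 ^ 2]. *)
Lemma step_exponential_moment (p a : R) : 0 <= p <= 1 -> `|a| <= 4^-1 ->
  p * expR (a * (1 - (2 * p - 1))) + (1 - p) * expR (a * (- 1 - (2 * p - 1)))
  <= expR (8 * a ^+ 2).
Proof.
move=> /andP[p0 p1] a4; move: (a4); rewrite ler_norml => /andP[a1 a2].
have E1 := @expR_le_quadratic (a * (1 - (2 * p - 1))).
have E2 := @expR_le_quadratic (a * (- 1 - (2 * p - 1))).
have {}E1 := E1 ltac:(by rewrite ler_norml; nra).
have {}E2 := E2 ltac:(by rewrite ler_norml; nra).
apply: le_trans (expR_ge1Dx _).
apply: (le_trans (lerD (ler_wpM2l p0 E1) (ler_wpM2l _ E2))); first by rewrite subr_ge0.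
have -> : 8 * a ^+ 2 = a ^+ 2 * 8 by rewrite mulrC.
have a20 : 0 <= a ^+ 2 by exact: sqr_ge0.
have : 8 * p * (1 - p) <= 8 by nra.
move=> /(ler_wpM2l a20).
lra.
Qed.

End chernoff.

Section geometric.
Context (R : realType).

Lemma geometric_tail_le (q : R) N H : 0 <= q < 1 ->
  \sum_(n <- iota N H) q ^+ n <= q ^+ N / (1 - q).
Proof.
move=> /andP[q0 q1]; have q1' : 0 < 1 - q by rewrite subr_gt0.
elim: H N => [|H ih] N /=.
  by rewrite big_nil divr_ge0 ?exprn_ge0// ltW.
rewrite big_cons; apply: (le_trans (lerD (lexx _) (ih _))).
rewrite le_eqVlt; apply/orP; left; apply/eqP; rewrite exprS.
by field; rewrite gt_eqF.
Qed.

Lemma small_power (q C e : R) : 0 <= q < 1 -> 0 < e ->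
  exists N, C * q ^+ N <= e.
Proof.
move=> /andP[q0 q1] e0; have := @cvg_geometric R C q.
rewrite ger0_norm// => /(_ q1)/cvgrPdist_le/(_ _ e0)[N _ /(_ N (leqnn _))].
by rewrite /= sub0r normrN => /(le_trans (ler_norm _)); exists N.
Qed.

(** Half of the exponential decay pays for the polynomial number of events in the
union bound, the factor being [size_frog_box n]. *)
Lemma box_exponential_bound (k : R) : 0 < k -> exists2 C : R, 0 <= C &
  forall n, (n.*2.+1 * n.+1)%:R * (2 * expR (- k) ^+ n) <=
    C * expR (- (k / 2)) ^+ n.
Proof.
move=> k0.
pose b := Num.min 1 (k / 4).
have b0 : 0 < b by rewrite /b lt_min ltr01 divr_gt0.
(* A quarter of the rate beats one linear factor, hence half of it the square. *)
have E2 n : b * n.+1%:R <= expR (k / 4) ^+ n.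
  rewrite -expRM_natl; apply: le_trans (expR_ge1Dx _).
  rewrite -natr1 mulrDr mulr1 addrC lerD ?ge_min ?lexx//.
  by rewrite mulrC ler_wpM2l// ge_min lexx orbT.
set q := expR (- (k / 2)).
exists (4 / b ^+ 2) => [|n]; first by rewrite divr_ge0// exprn_ge0// ltW.
have -> : expR (- k) ^+ n = q ^+ n / expR (k / 4) ^+ n / expR (k / 4) ^+ n.
  by rewrite -!expRM_natl -!expRN -!expRD; congr expR; field.
set M : R := _%:R; set r := expR (k / 4) ^+ n.
have r0 : 0 < r by rewrite exprn_gt0// expR_gt0.
have q0 : 0 <= q ^+ n by rewrite exprn_ge0// expR_ge0.
have sq : b ^+ 2 * n.+1%:R ^+ 2 <= r * r.
  by rewrite -exprMn expr2 ler_pM ?E2// mulr_ge0// ltW.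
have n2 : M * 2 <= 4 * n.+1%:R ^+ 2.
  have u0 : 0 <= n.+1%:R :> R by exact: ler0n.
  have : (n.*2.+1)%:R <= 2 * n.+1%:R :> R by rewrite -natrM ler_nat mul2n doubleS.
  by rewrite /M natrM => /(ler_wpM2r u0); lra.
have -> : M * (2 * (q ^+ n / r / r)) = M * 2 / (r * r) * q ^+ n.
  by field; rewrite gt_eqF.
rewrite ler_wpM2r// ler_pdivrMr ?mulr_gt0//; apply: (le_trans n2).
rewrite -mulrA ler_wpM2l// mulrC ler_pdivlMr ?exprn_gt0//.
by rewrite mulrC.
Qed.

End geometric.

Section deviations.
Context (R : realType).

(** Markov's inequality applied to the exponential moments of order [a] and [-a]
of the centred sum of the steps. *)
Lemma coin_mean_deviation (I : eqType) (p a b : R) (s : seq I) n x :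
  0 <= p <= 1 -> 0 <= a <= 4^-1 -> uniq s -> (size s <= n)%N ->
  coin_mean p s (fun y =>
    (b < `|\sum_(j <- s) ((y j)%:~R - (2 * p - 1))|)%R%:R) x
  <= 2 * expR (8 * a ^+ 2 * n%:R - a * b).
Proof.
move=> p01 /andP[a0 a4] us sn.
pose S (y : I -> int) : R := \sum_(j <- s) ((y j)%:~R - (2 * p - 1)).
have moment (c : R) : `|c| = a ->
    coin_mean p s (fun y => expR (- (a * b)) * expR (c * S y)) x <=
    expR (8 * a ^+ 2 * n%:R - a * b).
  move=> ca; rewrite coin_meanZ addrC expRD ler_pM2l ?expR_gt0//.
  pose g (v : int) : R := expR (c * (v%:~R - (2 * p - 1))).
  rewrite (_ : (fun y => expR (c * S y)) = (fun y => \prod_(j <- s) g (y j))).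
    rewrite coin_mean_prod_steps//.
    have c2 : c ^+ 2 = a ^+ 2 by rewrite -ca real_normK// num_real.
    apply: (@le_trans _ _ (expR (8 * a ^+ 2) ^+ size s)).
      apply: lerXn2r; rewrite ?nnegrE ?expR_ge0//.
        case/andP: p01 => p0 p1.
        by rewrite addr_ge0// mulr_ge0 ?expR_ge0// subr_ge0.
      by rewrite -c2; apply: step_exponential_moment => //; rewrite ca.
    rewrite (mulrC (8 * a ^+ 2)) (expRM_natl n); apply: ler_weXn2l => //.
    by rewrite -expR0 ler_expR mulr_ge0// sqr_ge0.
  by apply: funext => y; rewrite /S mulr_sumr expR_sum.
rewrite [leRHS]mulrDl mul1r; apply: le_trans (lerD (moment a _) (moment (- a) _)).
- rewrite -coin_meanD; apply: le_coin_mean => // y _; rewrite -/(S y) -!expRD.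
  have [bS|_] := ltP b `|S y|; last by rewrite addr_ge0// expR_ge0.
  have [S0|S0] := leP 0 (S y); [rewrite -[leLHS]addr0|rewrite -[leLHS]add0r];
    apply: lerD; rewrite ?expR_ge0// -expR0 ler_expR.
    by rewrite ger0_norm// in bS; nra.
  by rewrite ltr0_norm// in bS; nra.
- exact: ger0_norm.
- by rewrite normrN ger0_norm.
Qed.

End deviations.

Definition steps_after (i : int) (a H : nat) := [seq (i, k) | k <- iota a.+1 H].

Lemma mem_steps_after i a H z : z \in steps_after i a H -> z.1 = i.
Proof. by move=> /mapP[k _ ->]. Qed.

Lemma steps_after_uniq i a H : uniq (steps_after i a H).
Proof. by rewrite map_inj_uniq ?iota_uniq// => k l []. Qed.

Lemma steps_after_gt0 i a H : {in steps_after i a H, forall j, (0 < j.2)%N}.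
Proof.
move=> _ /mapP[k + ->]; rewrite mem_iota => /andP[ak _].
exact: leq_ltn_trans (leq0n a) ak.
Qed.

Definition walk_of (x : int * nat -> int) := walk (fun i k => x (i, k)).

Lemma walk_ofE x i n : walk_of x i n = \sum_(j <- steps_after i 0 n) x j.
Proof. by rewrite /walk_of /walk big_map /index_iota subSS subn0. Qed.

Section walks_lln.
Context d (Omega : measurableType d) (R : realType) (P : probability Omega R).
Context (p : R) (X : int * nat -> {RV P >-> int}).
Let D := [set ik : int * nat | (0 < ik.2)%N].
Context (p01 : 0 <= p <= 1).
Context (indep : mutually_independent D X).
Context (lawp : forall j, D j -> P (X j @^-1` [set 1]) = p%:E).
Context (lawm : forall j, D j -> P (X j @^-1` [set -1]) = (1 - p)%:E).

Definition deviates (e : R) (n : nat) (i : int) (m : nat) (x : int * nat -> int) :=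
  e * n%:R < `|(walk_of x i m)%:~R - (2 * p - 1) * m%:R|.

Lemma deviates_depends e n i m : depends_on (steps_after i 0 m) (deviates e n i m).
Proof.
move=> x y xy; rewrite /deviates !walk_ofE.
by congr (_ < `|_%:~R - _|); apply: eq_big_seq.
Qed.

Lemma prob_deviates (a e : R) n i m : 0 <= a <= 4^-1 -> (m <= n)%N ->
  (P [set w | deviates e n i m (steps X w)] <=
   (2 * expR (8 * a ^+ 2 * n%:R - a * (e * n%:R)))%:E)%E.
Proof.
move=> a01 mn.
rewrite (prob_steps_event indep lawp lawm (s := steps_after i 0 m) (fun=> 0)).
- rewrite lee_fin; have sm : size (steps_after i 0 m) = m by rewrite size_map size_iota.
  have smn : (size (steps_after i 0 m) <= n)%N by rewrite sm.
  apply: le_trans (coin_mean_deviation (e * n%:R) (fun=> 0) p01 a01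
    (steps_after_uniq i 0 m) smn).
  apply: le_coin_mean => // y _; rewrite /deviates walk_ofE.
  by rewrite big_split/= sumrN big_const_seq count_predT iter_addr_0 sm
    raddf_sum /= -[(2 * p - 1) *+ m]mulr_natr.
- exact: steps_after_uniq.
- exact: steps_after_gt0.
- exact: deviates_depends.
Qed.

(** Only frogs within distance [n] of the origin can be active at time [n], so the
union bound ranges over polynomially many pairs of a frog and a number of steps. *)
Definition frog_box (n : nat) : seq (int * nat) :=
  [seq (l%:Z - n%:Z, m) | l <- iota 0 n.*2.+1, m <- iota 0 n.+1].

Lemma mem_frog_box n (i : int) (m : nat) :
  ((i, m) \in frog_box n) = (`|i| <= n)%N && (m <= n)%N.
Proof.
apply/allpairsP/andP => [[[l m'] [ln mn [-> ->]]]|[ni mn]].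
  by move: ln mn; rewrite !mem_iota /=; lia.
exists (`|(i + n%:Z)%R|%N, m); rewrite !mem_iota /=.
by split; [lia|lia|congr pair; lia].
Qed.

Lemma size_frog_box n : size (frog_box n) = (n.*2.+1 * n.+1)%N.
Proof. by rewrite size_allpairs !size_iota. Qed.

(** Borel-Cantelli: the exponent [8 * a ^ 2 - a * e] is negative once [a] is small
compared with [e], and the decay survives the union bound over the box. *)
Lemma ae_deviates_eventually (e : R) : 0 < e ->
  {ae P, forall w, exists N, forall n i m, (N <= n)%N -> (`|i| <= n)%N ->
    (m <= n)%N -> ~~ deviates e n i m (steps X w)}.
Proof.
move=> e0; pose a := Num.min 4^-1 (e / 16).
have a01 : 0 < a <= 4^-1.
  by apply/andP; split; rewrite /a ?lt_min ?ge_min ?lexx// invr_gt0 ltr0n divr_gt0.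
have ae16 : a <= e / 16 by rewrite /a ge_min lexx orbT.
case/andP: (a01) => a0 a4; pose k := a * e / 2.
have k0 : 0 < k by rewrite divr_gt0// mulr_gt0.
have E1 n : expR (8 * a ^+ 2 * n%:R - a * (e * n%:R)) <= expR (- k) ^+ n.
  have a2 : 8 * a ^+ 2 <= k by rewrite /k; nra.
  rewrite -expRM_natl ler_expR; have := ler_wpM2r (ler0n R n) a2.
  by rewrite /k; lra.
pose q := expR (- (k / 2)).
have q01 : 0 <= q < 1.
  by rewrite expR_ge0 /= -expR0 ltr_expR oppr_lt0 divr_gt0.
have [C C0 E3] := box_exponential_bound k0.
pose E n := [set w | exists2 im, im \in frog_box n &
  deviates e n im.1 im.2 (steps X w)].
have mdev n i m : measurable [set w | deviates e n i m (steps X w)].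
  exact: measurable_steps_event (@deviates_depends e n i m).
have mE n : measurable (E n).
  by apply: (measurable_finite_union
    (E := fun im => [set w | deviates e n im.1 im.2 (steps X w)])) => im _.
have PE n : (P (E n) <= (C * q ^+ n)%:E)%E.
  apply: (@le_trans _ _ (\sum_(im <- frog_box n) (2 * expR (- k) ^+ n))%:E).
    apply: (prob_finite_union_le
      (E := fun im => [set w | deviates e n im.1 im.2 (steps X w)])) => [im _//|im].
    case: im => i m; rewrite mem_frog_box => /andP[_ mn].
    apply: (le_trans (prob_deviates _ _ (a := a) _ _)) => /=.
    - by rewrite ltW.
    - exact: mn.
    - by rewrite lee_fin ler_wpM2l.
  rewrite lee_fin big_const_seq count_predT size_frog_box iter_addr_0.
  by rewrite -[leLHS]mulr_natl; exact: E3.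
apply: negligible_of_covers => c c0.
have [N hN] := small_power (C / (1 - q)) q01 c0.
exists (fun H => [set w | exists2 n, n \in iota N H & E n w]); split.
- by move=> H; apply: measurable_finite_union => n _.
- move=> H w [n nH En]; exists n => //; move: nH; rewrite !mem_iota.
  by rewrite addnS ltnS => /andP[-> /ltnW].
- move=> H; apply: le_trans (prob_finite_union_le (c := fun n => C * q ^+ n) _ _) _.
  + by move=> n _.
  + by move=> n _.
  rewrite lee_fin -mulr_sumr; apply: le_trans hN.
  by rewrite (mulrAC C) -(mulrA C) ler_wpM2l ?geometric_tail_le.
move=> w /= /forallNP/(_ N) hw; apply: contrapT => nw; apply: hw => n i m Nn ni mn.
apply/negP => dev; apply: nw; exists (n - N).+1 => //.
exists n; first by rewrite mem_iota Nn addnS ltnS subnKC /=.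
by exists (i, m) => //; rewrite mem_frog_box ni mn.
Qed.

End walks_lln.

(** * Ruin of a single walk *)

Section ruin.
Implicit Types (H a M : nat) (x : int * nat -> int) (i : int).

(** Ruin within [H] steps of a gambler of fortune [j] who wins the steps of frog
[i] after time [a].  The recursion consumes the steps in order, so that conditioning
on the first of them is a computation. *)
Fixpoint ruined H a x i (j : int) : bool :=
  (j <= 0) || (if H is H'.+1 then ruined H' a.+1 x i (j + x (i, a.+1)) else false).

Lemma ruined_depends H a i j :
  depends_on (steps_after i a H) (fun x => ruined H a x i j).
Proof.
elim: H a j => [|H ih] a j x y xy //=; congr (_ || _).
rewrite xy ?mem_head//; apply: ih => k ks; apply: xy.
by rewrite inE ks orbT.
Qed.

Lemma ruined_of_sum H a x i j n : (n <= H)%N ->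
  j + \sum_(k <- iota a.+1 n) x (i, k) <= 0 -> ruined H a x i j.
Proof.
elim: H a j n => [|H ih] a j [|n] //= nH; rewrite ?big_nil ?addr0; try by move=> ->.
by rewrite big_cons addrA => /ih -> //; rewrite orbT.
Qed.

Lemma ruinedS H a x i j : ruined H a x i j -> ruined H.+1 a x i j.
Proof.
elim: H a j => [|H ih] a j; first by rewrite /= orbF => ->.
by move=> /orP[/= ->//|/ih h]; apply/orP; right.
Qed.

Context (R : realFieldType) (p : R) (p_half : 2^-1 < p) (p1 : p <= 1).

Definition ruin_ratio : R := (1 - p) / p.

Local Notation rho := ruin_ratio.

Lemma ruin_ratio_bounds : 0 <= rho < 1.
Proof.
have p0 : 0 < p by move: p_half; lra.
rewrite /ruin_ratio divr_ge0 ?subr_ge0 ?(ltW p0)//= ltr_pdivrMr//.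
by move: p_half; lra.
Qed.

(** First-step analysis: [rho ^ j] is the harmonic function
[p * rho ^ (j + 1) + (1 - p) * rho ^ (j - 1) = rho ^ j] of the walk. *)
Lemma ruin_probability_le H a i (j : nat) x :
  coin_mean p (steps_after i a H) (fun y => (ruined H a y i j%:Z)%:R) x <= rho ^+ j.
Proof.
have /andP[r0 r1] := ruin_ratio_bounds.
have p0 : 0 < p by move: p_half; lra.
elim: H a j x => [|H ih] a [|j] x.
- by [].
- by rewrite /= exprn_ge0.
- by rewrite (eq_coin_mean p (G := fun=> 1)) ?coin_mean_cst.
have step (v : int) (l : nat) : j.+1%:Z + v = l%:Z ->
    coin_mean p (steps_after i a.+1 H)
      (fun y => (ruined H.+1 a y i j.+1%:Z)%:R) (update x (i, a.+1) v) <= rho ^+ l.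
  move=> jv; apply: le_trans (ih a.+1 l (update x (i, a.+1) v)).
  apply: le_coin_mean => [|y hy]; first by rewrite p1 ltW.
  rewrite /= (hy (i, a.+1)) ?/update ?eqxx ?jv// -/(update _ _ _).
  by apply/mapP => -[k + [ak]]; rewrite -ak mem_iota; lia.
rewrite /=; have S1 := step 1 j.+2 ltac:(lia); have S2 := step (-1) j ltac:(lia).
have -> : rho ^+ j.+1 = p * rho ^+ j.+2 + (1 - p) * rho ^+ j.
  by rewrite !exprS /ruin_ratio; field; rewrite gt_eqF.
by apply: lerD; apply: ler_wpM2l => //; [exact: ltW|rewrite subr_ge0].
Qed.

End ruin.

(** * A site that is never visited from its right *)

Section products.
Context (R : realFieldType).

Lemma prod_indicator (T : Type) (s : seq T) (q : pred T) :
  (all q s)%:R = \prod_(t <- s) (q t)%:R :> R.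
Proof.
elim: s => [|t s ih] /=; first by rewrite big_nil.
by rewrite big_cons -ih -natrM mulnb.
Qed.

Lemma has_indicator (T : Type) (s : seq T) (q : pred T) :
  (has q s)%:R = 1 - \prod_(t <- s) (1 - (q t)%:R) :> R.
Proof.
rewrite -[has q s]negbK -all_predC.
have -> (b : bool) : (~~ b)%:R = 1 - b%:R :> R by case: b; rewrite ?subrr ?subr0.
rewrite prod_indicator; congr (_ - _); apply: eq_bigr => t _ /=.
by case: (q t); rewrite ?subrr ?subr0.
Qed.

(** Weierstrass' product inequality. *)
Lemma prod_subl_ge (T : Type) (s : seq T) (u : T -> R) :
  (forall t, 0 <= u t <= 1) ->
  0 <= \prod_(t <- s) (1 - u t) <= 1 /\
  1 - \sum_(t <- s) u t <= \prod_(t <- s) (1 - u t).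
Proof.
move=> u01; elim: s => [|t s [/andP[ih0 ih1] ih]].
  by rewrite !big_nil ler01 lexx subr0.
by rewrite !big_cons; have /andP[? ?] := u01 t; split; [apply/andP; split|]; nra.
Qed.

End products.

Lemma uniq_flatten_map (T U : eqType) (bs : seq T) (s : T -> seq U) :
  uniq bs -> (forall b, uniq (s b)) ->
  (forall b c z, z \in s b -> z \in s c -> b = c) ->
  uniq (flatten (map s bs)).
Proof.
move=> + us disj; elim: bs => [//|b bs ih] /= /andP[bbs /ih ubs].
rewrite cat_uniq us ubs andbT; apply/hasPn => z /flatten_mapP[c cbs zc].
by apply: contra bbs => zb; rewrite (disj b c z).
Qed.

(** The first [J] factors are positive, and the others multiply to at least [1/2]
when the tail of the geometric series from [J] on is at most [1/2]. *)
Lemma euler_product_lower_bound (R : realType) (q : R) : 0 <= q < 1 ->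
  exists2 c : R, 0 < c <= 1 & forall M, c <= \prod_(j <- iota 1 M) (1 - q ^+ j).
Proof.
move=> q01; have /andP[q0 q1] := q01.
have q01n (j : nat) : 0 <= q ^+ j <= 1 by rewrite exprn_ge0// exprn_ile1// (ltW q1).
have [J hJ] := small_power (q / (1 - q)) q01 (ltac:(lra) : 0 < 2^-1 :> R).
have prod_gt0 M : 0 < \prod_(j <- iota 1 M) (1 - q ^+ j).
  rewrite big_seq; apply: prodr_gt0 => j; rewrite mem_iota => /andP[j0 _].
  by rewrite subr_gt0 exprn_ilt1// -lt0n.
have prod_le1 s : 0 <= \prod_(j <- s) (1 - q ^+ j) <= 1.
  by have [] := prod_subl_ge s q01n.
exists (\prod_(j <- iota 1 J) (1 - q ^+ j) / 2).
  rewrite divr_gt0//= ler_pdivrMr//.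
  by have /andP[_] := prod_le1 (iota 1 J); lra.
move=> M; apply: (@le_trans _ _ (\prod_(j <- iota 1 (J + M)) (1 - q ^+ j))).
  rewrite iotaD big_cat /= ler_wpM2l ?(ltW (prod_gt0 J))//.
  have [_ prod_ge] := prod_subl_ge (iota (1 + J) M) q01n.
  apply: le_trans prod_ge.
  have := geometric_tail_le (1 + J) M q01.
  have -> : q ^+ (1 + J) / (1 - q) = q / (1 - q) * q ^+ J.
    by rewrite add1n exprS mulrAC.
  lra.
rewrite addnC iotaD big_cat /= ler_piMr ?(ltW (prod_gt0 M))//.
by have /andP[] := prod_le1 (iota (1 + M) J).
Qed.

Section blocks.
Implicit Types (H M K : nat) (y : int) (x : int * nat -> int).

Definition reached_from_block H M y x :=
  has (fun j : nat => ruined H 0 x (y + j%:Z) j%:Z) (iota 1 M).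

Definition block_steps H M y :=
  flatten [seq steps_after (y + j%:Z) 0 H | j <- iota 1 M].

Lemma block_steps_uniq H M y : uniq (block_steps H M y).
Proof.
apply: uniq_flatten_map => [|j|j l z].
- exact: iota_uniq.
- exact: steps_after_uniq.
by move=> /mem_steps_after zj /mem_steps_after; rewrite zj; lia.
Qed.

Lemma reached_from_block_depends H M y :
  depends_on (block_steps H M y) (reached_from_block H M y).
Proof.
move=> x z xz; apply: eq_in_has => j jM; apply: ruined_depends => k kj.
by apply: xz; apply/flatten_mapP; exists j.
Qed.

(** The frogs to the right of these sites up to distance [M] form disjoint blocks,
and [k.+1] instead of [k] keeps the sites below the origin. *)
Definition block_site M (k : nat) : int := - (k.+1 * M)%N%:Z.

Definition reached_from_blocks H M K x :=
  all (fun k => reached_from_block H M (block_site M k) x) (iota 0 K).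

Definition blocks_steps H M K :=
  flatten [seq block_steps H M (block_site M k) | k <- iota 0 K].

Lemma blocks_steps_uniq H M K : uniq (blocks_steps H M K).
Proof.
apply: uniq_flatten_map => [|k|k l z].
- exact: iota_uniq.
- exact: block_steps_uniq.
move=> /flatten_mapP[j +/mem_steps_after jz] /flatten_mapP[j' +/mem_steps_after].
rewrite jz !mem_iota /block_site => jM jM'; have [kl|lk|//] := ltngtP k l.
- have : (k.+2 * M <= l.+1 * M)%N by rewrite leq_mul2r ltnS kl orbT.
  by rewrite mulSn; lia.
- have : (l.+2 * M <= k.+1 * M)%N by rewrite leq_mul2r ltnS lk orbT.
  by rewrite mulSn; lia.
Qed.

Lemma reached_from_blocks_depends H M K :
  depends_on (blocks_steps H M K) (reached_from_blocks H M K).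
Proof.
move=> x z xz; apply: eq_in_all => k kK; apply: reached_from_block_depends => i ik.
by apply: xz; apply/flatten_mapP; exists k.
Qed.

Context (R : realType) (p : R) (p_half : 2^-1 < p) (p1 : p <= 1).

Local Notation rho := (ruin_ratio p).

(** The frogs of a block all miss its left end with probability at least [c], by
independence of their walks and the ruin estimate for each of them. *)
Lemma prob_reached_from_block_le (c : R) H M y x :
  (forall N, c <= \prod_(j <- iota 1 N) (1 - rho ^+ j)) ->
  coin_mean p (block_steps H M y) (fun z => (reached_from_block H M y z)%:R) x
  <= 1 - c.
Proof.
move=> hc; under (eq_coin_mean p) => z _ do rewrite has_indicator.
rewrite coin_mean_subl lerD2l lerN2 (le_trans (hc M))//.
rewrite (coin_mean_prod p (s := fun j : nat => steps_after (y + j%:Z) 0 H)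
  (F := fun (j : nat) z => 1 - (ruined H 0 z (y + j%:Z) j%:Z)%:R)).
- have /andP[r0 r1] := ruin_ratio_bounds p_half p1.
  apply: ler_prod => j _; rewrite coin_mean_subl subr_ge0 exprn_ile1 ?(ltW r1)//=.
  by rewrite lerD2l lerN2 ruin_probability_le.
- exact: block_steps_uniq.
- by move=> j z z' zz'; rewrite (ruined_depends _ zz').
Qed.

Lemma prob_reached_from_blocks_le (c : R) H M K x : c <= 1 ->
  (forall N, c <= \prod_(j <- iota 1 N) (1 - rho ^+ j)) ->
  coin_mean p (blocks_steps H M K) (fun z => (reached_from_blocks H M K z)%:R) x
  <= (1 - c) ^+ K.
Proof.
move=> c1 hc; under (eq_coin_mean p) => z _ do rewrite prod_indicator.
rewrite (coin_mean_prod p (s := fun k => block_steps H M (block_site M k))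
  (F := fun k z => (reached_from_block H M (block_site M k) z)%:R)).
- apply: (@le_trans _ _ (\prod_(k <- iota 0 K) (1 - c))).
    apply: ler_prod => k _; rewrite prob_reached_from_block_le// andbT.
    by apply: coin_mean_ge0 => //; rewrite p1 andbT ltW// (lt_trans _ p_half).
  by rewrite big_const_seq count_predT size_iota iter_mulr_1.
- exact: blocks_steps_uniq.
- by move=> k z z' zz'; rewrite (reached_from_block_depends zz').
Qed.

End blocks.

Section blocked_site.
Context d (Omega : measurableType d) (R : realType) (P : probability Omega R).
Context (p : R) (X : int * nat -> {RV P >-> int}).
Let D := [set ik : int * nat | (0 < ik.2)%N].
Context (p_half : 2^-1 < p) (p1 : p <= 1).
Context (indep : mutually_independent D X).
Context (lawp : forall j, D j -> P (X j @^-1` [set 1]) = p%:E).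
Context (lawm : forall j, D j -> P (X j @^-1` [set -1]) = (1 - p)%:E).

Local Notation rho := (ruin_ratio p).

Lemma prob_ruined_le H i (j : nat) :
  (P [set w | ruined H 0 (steps X w) i j%:Z] <= (rho ^+ j)%:E)%E.
Proof.
have PE := prob_steps_event indep lawp lawm (fun=> 0) (steps_after_uniq i 0 H)
  (@steps_after_gt0 i 0 H) (@ruined_depends H 0 i j%:Z).
by rewrite [leLHS]PE lee_fin ruin_probability_le.
Qed.

(** The left ends of [K] disjoint blocks of [M] frogs are all reached from their
own block with probability at most [(1 - c) ^ K] by independence, and from
farther away with probability at most a geometric tail in [M]; [K] is chosen
first, then [M]. *)
Lemma ae_blocked_site : {ae P, forall w, exists2 y : int, y < 0 &
  forall i n, y < i -> y < i + walk_of (steps X w) i n}.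
Proof.
have r01 := ruin_ratio_bounds p_half p1; have /andP[r0 r1] := r01.
have [c /andP[c0 c1] hc] := euler_product_lower_bound r01.
apply: negligible_of_covers => e e0; have e2 : 0 < e / 2 by rewrite divr_gt0.
have [K hK] := small_power 1 (ltac:(lra) : 0 <= 1 - c < 1) e2.
have [M0 hM] := small_power (K%:R * (rho ^+ 2 / (1 - rho))) r01 e2.
pose M := M0.+1.
pose near_ev H := [set w | reached_from_blocks H M K (steps X w)].
pose far_ev H (kj : nat * nat) :=
  [set w | ruined H 0 (steps X w) (block_site M kj.1 + kj.2%:Z) kj.2%:Z].
pose far_index H := [seq (k, j) | k <- iota 0 K, j <- iota M.+1 H].
pose far H := [set w | exists2 kj, kj \in far_index H & far_ev H kj w].
have mnear H : measurable (near_ev H).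
  exact: measurable_steps_event (@reached_from_blocks_depends H M K).
have mfar_ev H kj : measurable (far_ev H kj).
  exact: measurable_steps_event (@ruined_depends H 0 _ _).
have mfar H : measurable (far H) by apply: measurable_finite_union => kj _.
exists (fun H => near_ev H `|` far H); split.
- by move=> H; exact: measurableU.
- move=> H w [/allP near_w|[[k j] kj rw]]; [left|right].
    apply/allP => k /near_w /hasP[j jM rj]; apply/hasP; exists j => //.
    exact: ruinedS.
  exists (k, j); last exact: ruinedS.
  case/allpairsP: kj => -[k' j'] [k'K j'H [-> ->]].
  apply/allpairsP; exists (k', j'); split => //.
  by move: j'H; rewrite !mem_iota /= addnS ltnS => /andP[-> /ltnW].
- move=> H; apply: (le_trans (measureU2 P (mnear H) (mfar H))).
  rewrite [in leRHS](splitr e) EFinD; apply: leeD.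
    have sD : {in blocks_steps H M K, forall j, D j}.
      by move=> i /flatten_mapP[k _] /flatten_mapP[j _]; exact: steps_after_gt0.
    have PE := prob_steps_event indep lawp lawm (fun=> 0)
      (blocks_steps_uniq H M K) sD (@reached_from_blocks_depends H M K).
    rewrite [leLHS]PE lee_fin; apply: le_trans hK; rewrite mul1r.
    exact: prob_reached_from_blocks_le.
  apply: le_trans (prob_finite_union_le (c := fun kj => rho ^+ kj.2) _ _) _.
  + by move=> kj _.
  + by move=> kj _; exact: prob_ruined_le.
  rewrite lee_fin big_allpairs /= big_const_seq count_predT size_iota iter_addr_0.
  rewrite -[leLHS]mulr_natl; apply: le_trans hM; rewrite -mulrA ler_wpM2l//.
  apply: le_trans (geometric_tail_le M.+1 H r01) _.
  have -> : rho ^+ M.+1 = rho ^+ 2 * rho ^+ M0 by rewrite -exprD.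
  by rewrite mulrAC.
move=> w /= nw.
have reach k : exists jn : nat * nat, (0 < jn.1)%N /\
    jn.1%:Z + walk_of (steps X w) (block_site M k + jn.1%:Z) jn.2 <= 0.
  apply: contrapT => nreach; apply: nw; exists (block_site M k).
    by rewrite /block_site oppr_lt0.
  move=> i n ki; rewrite ltNge; apply/negP => h; apply: nreach.
  have ki0 : 0 < i - block_site M k by rewrite subr_gt0.
  exists (`|(i - block_site M k)%R|%N, n).
  rewrite /= gtz0_abs// absz_gt0 gt_eqF//; split => //.
  by rewrite (addrC (block_site M k)) subrK addrAC subr_le0.
have /choice[f hf] := reach.
(* A horizon within which all the visits to the [K] sites have happened, and
   which also bounds the distances of the visiting frogs to these sites. *)
pose H := \max_(k < K) maxn (f k).1 (f k).2.
have fH k : (k < K)%N -> (maxn (f k).1 (f k).2 <= H)%N.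
  by move=> kK; have := @leq_bigmax _ (fun k : 'I_K => maxn (f k).1 (f k).2) (Ordinal kK).
have fruined k : (k < K)%N ->
    ruined H 0 (steps X w) (block_site M k + (f k).1%:Z) (f k).1%:Z.
  move=> kK; apply: (@ruined_of_sum _ _ _ _ _ (f k).2).
    by apply: leq_trans (fH k kK); exact: leq_maxr.
  by have [_] := hf k; rewrite walk_ofE big_map.
exists H => //.
have [near_w|far_w] := boolP (all (fun k => ((f k).1 <= M)%N) (iota 0 K)); [left|right].
  apply/allP => k kK; apply/hasP; exists (f k).1.
    have [f0 _] := hf k; rewrite mem_iota f0 add1n ltnS.
    by move/allP: near_w; exact.
  by apply: fruined; move: kK; rewrite mem_iota.
move: far_w; rewrite -has_predC => /hasP[k kK]; rewrite /= -ltnNge => Mf.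
exists (k, (f k).1); last by apply: fruined; move: kK; rewrite mem_iota.
apply/allpairsP; exists (k, (f k).1); split => //.
rewrite mem_iota /= Mf addSn ltnS; apply: leq_trans (leq_addl _ _).
by move: kK; rewrite mem_iota => /fH; exact/leq_trans/leq_maxl.
Qed.

End blocked_site.

(** * The frog model along a fixed realization of the steps *)

Section frog.
Context (R : realType) (s : int -> nat -> int).
Implicit Types (i x y : int) (n m t : nat).

Local Notation T := (activation_time R s).

Lemma walkS i n : walk s i n.+1 = walk s i n + s i n.+1.
Proof. by rewrite /walk big_nat_recr. Qed.

Lemma walk0 i : walk s i 0 = 0.
Proof. by rewrite /walk big_geq. Qed.

Lemma hitting_time_ge0 x y : (0 <= hitting_time R s x y)%E.
Proof. by apply: le_ereal_inf_tmp => _ [n _ <-]; rewrite lee_fin. Qed.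

Lemma activation_time_le i n : walk s 0 n = i -> (T i <= n%:R%:E)%E.
Proof.
move=> wi; apply: (@le_trans _ _ (hitting_time R s 0 i)).
  apply: ereal_inf_lbound; exists 1%N, (fun l => if l is 0%N then 0 else i).
  by split => //; rewrite big_nat1.
by apply: ereal_inf_lbound; exists n => //=; rewrite add0r.
Qed.

Lemma location_active i t n : T i = t%:R%:E -> (t <= n)%N ->
  location R s i n = i + walk s i (n - t).
Proof.
move=> Ti tn; rewrite /location Ti lte_fin ltr_nat ltnNge tn /=.
by rewrite natrK.
Qed.

Lemma active_nat i n : active R s n i -> exists2 t, (t <= n)%N & T i = t%:R%:E.
Proof.
rewrite /active /=; have [->//|[t ->]] := activation_time_nat R s i.
by rewrite lee_fin ler_nat => tn; exists t.
Qed.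

(** A chain of frogs waking each other would have to cross [y], and its first
frog beyond [y] would be hit from the right of [y]. *)
Lemma activation_time_blocked y i : y < 0 ->
  (forall x n, y < x -> y < x + walk s x n) -> i <= y -> T i = +oo%E.
Proof.
move=> y0 blocked iy; apply/eqP; rewrite -leye_eq.
apply: le_ereal_inf_tmp => _ [k [x [_ x0 xk ->]]]; rewrite leye_eq; apply/eqP.
have xky : x k <= y by rewrite xk.
elim: k {xk} xky => [|k ih] xky; first by move: xky; rewrite x0 leNgt y0.
have sum0 : (0 <= \sum_(1 <= l < k.+1) hitting_time R s (x l.-1) (x l))%E.
  by apply: sume_ge0 => l _; exact: hitting_time_ge0.
rewrite big_nat_recr//=; have [/ih ->|yx] := leP (x k) y.
  rewrite addye// gt_eqF// (lt_le_trans _ (hitting_time_ge0 _ _))//.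
rewrite (_ : hitting_time R s (x k) (x k.+1) = +oo%E).
  by rewrite addey// gt_eqF// (lt_le_trans _ sum0).
rewrite /hitting_time (_ : [set n | _] = set0) ?image_set0 ?ereal_inf0//.
apply/seteqP; split => n //= hn; have := blocked (x k) n yx.
by rewrite hn ltNge xky.
Qed.

Context (s_pm1 : forall i n, s i n.+1 = 1 \/ s i n.+1 = -1).

Lemma walk_norm_le i n : `|walk s i n| <= n%:Z.
Proof.
elim: n => [|n ih]; first by rewrite walk0.
by rewrite walkS; have [->|->] := s_pm1 i n; lia.
Qed.

(** Walks are nearest neighbour, so each link of a chain of wakings takes at least
as much time as the distance that it covers. *)
Lemma norm_le_activation_time i : (`|i|%:~R%:E <= T i)%E.
Proof.
apply: le_ereal_inf_tmp => _ [k [x [_ x0 <- ->]]].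
elim: k => [|k ih]; first by rewrite x0 normr0 big_geq.
rewrite big_nat_recr//=.
apply: (@le_trans _ _ (`|x k|%:~R%:E + `|x k.+1 - x k|%:~R%:E)%E).
  by rewrite -EFinD lee_fin -intrD ler_int; lia.
apply: leeD => //; apply: le_ereal_inf_tmp => _ [n /= <- <-].
rewrite lee_fin [X in `|X|]addrC addKr -[n%:R]/(n%:Z%:~R) ler_int.
exact: walk_norm_le.
Qed.

(** A walk with steps of size one cannot jump over a site. *)
Lemma walk_attains i t : 0 <= i -> i < walk s 0 t ->
  exists2 m, (m < t)%N & walk s 0 m = i.
Proof.
move=> i0; elim: t => [|t ih]; first by rewrite walk0; lia.
rewrite walkS => it; have [/ih[m mt mi]|wi|wi] := ltgtP i (walk s 0 t).
- by exists m => //; exact: ltnW.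
- by exfalso; have [h|h] := s_pm1 0 t; rewrite h in it; lia.
- by exists t.
Qed.

(** If frog [0] were to the right of [i] at the time when frog [i] wakes, it would
have visited [i], and woken that frog, earlier. *)
Lemma walk_le_activation i t : 0 <= i -> T i = t%:R%:E -> walk s 0 t <= i.
Proof.
move=> i0 Ti; rewrite leNgt; apply/negP => /(walk_attains i0)[m mt wm].
by have := activation_time_le wm; rewrite Ti lee_fin ler_nat leqNgt mt.
Qed.

(** Applied to the frogs between the blocked site and the origin: being finitely
many, those of them that wake do so before a common time. *)
Lemma activation_times_bounded k : exists B, forall i t,
  (`|i| <= k)%N -> T i = t%:R%:E -> (t <= B)%N.
Proof.
have bound1 i : exists B, forall t, T i = t%:R%:E -> (t <= B)%N.
  have [->|[n ->]] := activation_time_nat R s i; first by exists 0%N.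
  by exists n => t [/eqP]; rewrite eqr_nat => /eqP ->.
elim: k => [|k [B hB]].
  have [B hB] := bound1 0; exists B => i t; rewrite leqn0 absz_eq0 => /eqP ->.
  exact: hB.
have [[B1 hB1] [B2 hB2]] := (bound1 k.+1%:Z, bound1 (- k.+1%:Z)).
exists (maxn B (maxn B1 B2)) => i t ik Ti; rewrite !leq_max.
have [ik'|ki] := leqP `|i| k; first by rewrite (hB i t).
have [ie|ie] : i = k.+1%:Z \/ i = - k.+1%:Z by lia.
- by rewrite hB1 ?orbT// -ie.
- by rewrite hB2 ?orbT// -ie.
Qed.

(** The frogs woken at [i >= 0] are not much behind [v * n], since frog [0] was at
[i] or to its left when they woke; the frogs woken to the left of the origin are
finitely many, with bounded delay and starting point. *)
Lemma min_location_cvg (v : R) y : 0 <= v -> y < 0 ->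
  (forall x n, y < x -> y < x + walk s x n) ->
  (forall e : R, 0 < e -> exists N, forall n i m, (N <= n)%N -> (`|i| <= n)%N ->
     (m <= n)%N -> `|(walk s i m)%:~R - v * m%:R| <= e * n%:R) ->
  (fun n : nat => (min_location R s n)%:~R / n%:R : R) @ \oo --> v.
Proof.
move=> v0 y0 blocked lln; apply/cvgrPdist_le => e e0.
have e2 : 0 < e / 2 by rewrite divr_gt0.
have [N hN] := lln _ e2; have [B hB] := activation_times_bounded `|y|.
(* After time [c], the delay and the starting point of the frogs between [y] and
   the origin are absorbed into [e / 2 * n]. *)
pose c := (`|y|%:~R + v * B%:R) / (e / 2).
exists (maxn N (maxn 1 (Num.truncn c).+1)) => // n /=; rewrite !geq_max.
move=> /and3P[Nn n0 cn]; have nR : 0 < n%:R :> R by rewrite ltr0n.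
have {}cn : `|y|%:~R + v * B%:R <= e / 2 * n%:R.
  rewrite [leRHS]mulrC -ler_pdivrMr// -/c (le_trans (ltW (truncnS_gt c)))//.
  by rewrite ler_nat.
have [[i iA <-] lb] := min_location_is_minimum R s n.
rewrite distrC.
have -> : (location R s i n)%:~R / n%:R - v =
    ((location R s i n)%:~R - v * n%:R) / n%:R.
  by rewrite mulrBl mulfK ?gt_eqF.
rewrite normrM normfV (gtr0_norm nR) ler_pdivrMr// ler_norml; apply/andP; split.
  have [t tn Ti] := active_nat iA; rewrite (location_active Ti tn) intrD.
  have it : `|i|%:Z <= t%:Z.
    by have := norm_le_activation_time i; rewrite Ti lee_fin -[t%:R]/(t%:Z%:~R) ler_int.
  have := hN n i (n - t)%N Nn ltac:(lia) (leq_subr _ _).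
  rewrite ler_norml natrB// => /andP[+ _].
  have [i0|i0] := leP 0 i.
    have := walk_le_activation i0 Ti; rewrite -(ler_int R).
    have := hN n 0 t Nn ltac:(lia) tn; rewrite ler_norml => /andP[+ _].
    lra.
  have [iy|yi] := leP i y.
    by have := activation_time_blocked y0 blocked iy; rewrite Ti.
  have tB : (t <= B)%N by apply: (hB i) => //; lia.
  have : - (`|y|%:~R) <= i%:~R :> R by rewrite -mulrNz ler_int; lia.
  have : v * t%:R <= v * B%:R by rewrite ler_wpM2l// ler_nat.
  lra.
have T0 : T 0 = 0%:R%:E by exact: activation_time0.
have : location R s i n <= location R s 0 n.
  by apply: lb; exists 0 => //; rewrite /active /= T0 lee_fin.
rewrite (location_active T0)// add0r subn0 -(ler_int R).
have := hN n 0 n Nn isT (leqnn _); rewrite ler_norml => /andP[_].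
have : 0 <= e / 2 * n%:R by rewrite mulr_ge0// ltW.
lra.
Qed.

End frog.

(** * The speed of the minimum *)

(** The hypotheses on the law leave no mass outside [1] and [-1]. *)
Lemma ae_steps_pm1 d (Omega : measurableType d) (R : realType)
    (P : probability Omega R) (I : countType) (D : set I) (p : R)
    (X : I -> {RV P >-> int}) :
  (forall j, D j -> P (X j @^-1` [set 1]) = p%:E) ->
  (forall j, D j -> P (X j @^-1` [set -1]) = (1 - p)%:E) ->
  {ae P, forall w, forall j, D j -> X j w = 1 \/ X j w = -1}.
Proof.
move=> lawp lawm.
have step j : D j -> {ae P, forall w, X j w = 1 \/ X j w = -1}.
  move=> Dj; exists (~` [set w | X j w = 1 \/ X j w = -1]).
  have m : measurable [set w | X j w = 1 \/ X j w = -1].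
    by apply: measurableU; exact: measurable_step.
  split => //; first exact: measurableC.
  by rewrite probability_setC// [X in (1 - X)%E](prob_step_pm1 lawp lawm Dj) subee.
have : {ae P, forall w, forall n : nat, if @choice.unpickle I n is Some j then
    D j -> X j w = 1 \/ X j w = -1 else True}.
  apply: ae_foralln => n; case: (choice.unpickle n) => [j|]; last exact: aeW.
  by have [/step|nDj] := pselect (D j); [apply: filterS|exact: aeW].
apply: filterS => w h j; have := h (choice.pickle j).
by rewrite choice.pickleK.
Qed.

Theorem theorem1p1 (R : realType) (d : measure_display)
    (Omega : measurableType d) (P : probability Omega R) (p : R)
    (X : int -> nat -> {RV P >-> int}) :
  2^-1 < p -> p <= 1 ->
  iid [set ik : int * nat | (0 < ik.2)%N] (fun ik => X ik.1 ik.2) ->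
  P (X 0 1%N @^-1` [set 1]) = p%:E ->
  P (X 0 1%N @^-1` [set -1]) = (1 - p)%:E ->
  {ae P, forall w : Omega,
    (fun n : nat => (min_location R (fun i k => X i k w) n)%:~R / n%:R : R)
      @ \oo --> 2 * p - 1}.
Proof.
move=> p_half p1 [indep ident] X1 Xm1.
have p01 : 0 <= p <= 1 by lra.
pose D := [set ik : int * nat | (0 < ik.2)%N].
pose Y (ik : int * nat) := X ik.1 ik.2.
have lawp j : D j -> P (Y j @^-1` [set 1]) = p%:E.
  by move=> Dj; rewrite -X1; exact: (ident j (0, 1%N) Dj isT [set 1]).
have lawm j : D j -> P (Y j @^-1` [set -1]) = (1 - p)%:E.
  by move=> Dj; rewrite -Xm1; exact: (ident j (0, 1%N) Dj isT [set -1]).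
have aepm := ae_steps_pm1 lawp lawm.
(* The tolerances [1 / (l + 1)] suffice, and countably many almost sure events hold
   together. *)
have aelln : {ae P, forall w, forall l : nat, exists N, forall n i m, (N <= n)%N ->
    (`|i| <= n)%N -> (m <= n)%N -> ~~ deviates p l.+1%:R^-1 n i m (steps Y w)}.
  apply: ae_foralln => l.
  by apply: (ae_deviates_eventually p01 indep lawp lawm); rewrite invr_gt0.
have aeblock := ae_blocked_site p_half p1 indep lawp lawm.
apply: filterS3 aepm aelln aeblock => w pm lln [y y0 blocked].
apply: (@min_location_cvg R (fun i k => X i k w) _ (2 * p - 1) y) => //.
- by move=> i n; exact: (pm (i, n.+1)).
- by lra.
- move=> e e0; pose l := Num.truncn e^-1; have [N hN] := lln l.
  exists N => n i m Nn ni mn; have := hN n i m Nn ni mn.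
  rewrite /deviates -leNgt => /le_trans; apply.
  by rewrite ler_wpM2r// invf_ple ?posrE// ltW// truncnS_gt.
Qed.
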